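(* Let $(a_i)_{i\ge1},(b_i)_{i\ge1}$ be nonnegative integers with $a_1=b_1=1$, let $(c_i)_{i\ge1}$ be integers, and fix a sign $\epsilon\in\{+1,-1\}$. Define Laurent polynomials $F_n(z)$ by \[ \sum_{n\ge0}F_n(z)q^n=\prod_{i\ge1}(1-zq^i)^{-a_i}(1-z^{-1}q^i)^{-b_i}(1+\epsilon q^i)^{c_i}. \] Then for all $n\ge0$ and $0\le k\le n/2$, \[ [z^{n-k}]F_n(z)=[z^{n+1-k}]F_{n+1}(z),\qquad [z^{-(n-k)}]F_n(z)=[z^{-(n+1-k)}]F_{n+1}(z). \]
   Context: $[z^k]$ denotes the coefficient of $z^k$ in a Laurent polynomial. *)

(* Defs.v *)
From HB Require Import structures.
From mathcomp Require Import all_boot all_order all_algebra.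
From mathcomp Require Import boolp.
From mathcomp Require Import freeg.
Set Implicit Arguments. Unset Strict Implicit. Unset Printing Implicit Defensive.
Import GRing.Theory.
Local Open Scope ring_scope.

(* The Laurent polynomial ring R[z, z^-1] is the group ring of (int, +): its
   underlying module is the library's free module on [int], in which
   [<< r *g k >>] stands for the monomial r z^k and [freeg.coeff k] extracts
   the coefficient of z^k. *)
Definition laurent (R : comNzRingType) : Type := {freeg int / R}.

HB.instance Definition _ (R : comNzRingType) :=
  GRing.Lmodule.copy (laurent R) {freeg int / R}.

HB.instance Definition _ (R : nzRingType) (K : choiceType) (M : lmodType R)
    (u : K -> M) :=
  GRing.isZmodMorphism.Build {freeg K / R} M (fglift u) (lift_is_additive u).

Section Laurent.
Variable R : comNzRingType.
Implicit Types f g h : laurent R.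

Definition laurent_coef (f : laurent R) (k : int) : R := freeg.coeff k f.

Definition laurent_mono (r : R) (k : int) : laurent R := << r *g k >>.

Definition laurent_one : laurent R := laurent_mono 1 0.

Definition laurent_mul (f g : laurent R) : laurent R :=
  \sum_(i <- dom f) \sum_(j <- dom g)
     laurent_mono (laurent_coef f i * laurent_coef g j) (i + j).

Let shift (i j : int) : laurent R := laurent_mono 1 (i + j).

Lemma fglift_dom (M : lmodType R) (u : int -> M) f :
  fglift u f = \sum_(i <- dom f) freeg.coeff i f *: u i.
Proof.
rewrite -{1}[f]freeg_sumE raddf_sum.
by apply: eq_bigr => i _ /=; rewrite liftU.
Qed.

Let scaleU (r s : R) (k : int) :
  r *: laurent_mono s k = laurent_mono (r * s) k.
Proof.
apply/eqP/freeg_eqP => j; rewrite coeffZ !coeffU; exact: mulrA.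
Qed.

Let mulE f g :
  laurent_mul f g = fglift (fun i => fglift (shift i) g : laurent R) f.
Proof.
rewrite fglift_dom; apply: eq_bigr => i _.
rewrite fglift_dom scaler_sumr; apply: eq_bigr => j _.
by rewrite scalerA scaleU mulr1.
Qed.

Let mulDl : left_distributive laurent_mul +%R.
Proof. by move=> f g h; rewrite !mulE raddfD. Qed.

Let mulC : commutative laurent_mul.
Proof.
move=> f g; rewrite /laurent_mul exchange_big /=; apply: eq_bigr => j _.
by apply: eq_bigr => i _; rewrite mulrC addrC.
Qed.

Let mulDr : right_distributive laurent_mul +%R.
Proof. by move=> f g h; rewrite mulC mulDl !(mulC f). Qed.

Let mul0 f : laurent_mul 0 f = 0.
Proof. by rewrite mulE raddf0. Qed.

Let mulU r s i j :
  laurent_mul (laurent_mono r i) (laurent_mono s j) = laurent_mono (r * s) (i + j).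
Proof. by rewrite mulE !liftU scalerA scaleU mulr1. Qed.

Let sumE f : f = \sum_(i <- dom f) laurent_mono (laurent_coef f i) i.
Proof. by rewrite [RHS]freeg_sumE. Qed.

Let mul_suml (I : Type) (s : seq I) (F : I -> laurent R) g :
  laurent_mul (\sum_(i <- s) F i) g = \sum_(i <- s) laurent_mul (F i) g.
Proof. by apply: (big_morph (fun x => laurent_mul x g)). Qed.

Let mul_sumr (I : Type) (s : seq I) (F : I -> laurent R) g :
  laurent_mul g (\sum_(i <- s) F i) = \sum_(i <- s) laurent_mul g (F i).
Proof. by rewrite mulC mul_suml; apply: eq_bigr => i _; rewrite mulC. Qed.

Let mulA : associative laurent_mul.
Proof.
move=> f g h.
rewrite [f]sumE !mul_suml; apply: eq_bigr => i _.
rewrite [g]sumE !(mul_suml, mul_sumr); apply: eq_bigr => j _.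
rewrite [h]sumE !mul_sumr; apply: eq_bigr => k _.
by rewrite !mulU mulrA addrA.
Qed.

Let mul1 : left_id laurent_one laurent_mul.
Proof.
move=> f; rewrite {1}[f]sumE mul_sumr [RHS]sumE; apply: eq_bigr => i _.
by rewrite mulU mul1r add0r.
Qed.

Let one_neq0 : laurent_one != 0.
Proof. by rewrite /laurent_one /laurent_mono freegU_eq0 oner_neq0. Qed.

HB.instance Definition _ := GRing.Zmodule_isComNzRing.Build (laurent R)
  mulA mulC mul1 mulDl one_neq0.

Lemma laurent_coefU r k j :
  laurent_coef (laurent_mono r k) j = if j == k then r else 0.
Proof.
rewrite /laurent_coef coeffU eq_sym; case: eqP => _; first exact: mulr1.
exact: mulr0.
Qed.

Lemma laurent_coefD f g k :
  laurent_coef (f + g) k = laurent_coef f k + laurent_coef g k.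
Proof. exact: coeffD. Qed.

Lemma laurent_monoM r s i j :
  laurent_mono r i * laurent_mono s j = laurent_mono (r * s) (i + j).
Proof. exact: mulU. Qed.

Lemma laurentP f g : laurent_coef f =1 laurent_coef g <-> f = g.
Proof. by split=> [e|->//]; apply/eqP/freeg_eqP. Qed.

End Laurent.

Notation "''z^' k" := (laurent_mono 1 k) (at level 8, k at level 2, format "''z^' k") : ring_scope.

Record fps (R : comNzRingType) := FPS { fps_coef :> nat -> R }.

HB.instance Definition _ (R : comNzRingType) := gen_eqMixin (fps R).
HB.instance Definition _ (R : comNzRingType) := gen_choiceMixin (fps R).

Section Fps.
Variable R : comNzRingType.
Implicit Types f g h : fps R.

Lemma fpsP f g : (forall n, f n = g n) <-> f = g.
Proof.
split=> [|->//]; case: f g => [f] [g] /= e; congr FPS; exact/funext.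
Qed.

Definition fpsC (r : R) : fps R := FPS (fun n => if n == 0%N then r else 0).
Definition fpsX : fps R := FPS (fun n => (n == 1%N)%:R).

Definition fps_add f g : fps R := FPS (fun n => f n + g n).
Definition fps_opp f : fps R := FPS (fun n => - f n).
Definition fps_mul f g : fps R :=
  FPS (fun n => \sum_(i < n.+1) f i * g (n - i)%N).

Let addA : associative fps_add.
Proof. by move=> f g h; apply/fpsP => n; rewrite /= addrA. Qed.
Let addC : commutative fps_add.
Proof. by move=> f g; apply/fpsP => n; rewrite /= addrC. Qed.
Let add0 : left_id (fpsC 0) fps_add.
Proof. by move=> f; apply/fpsP => n; rewrite /= if_same add0r. Qed.
Let addN : left_inverse (fpsC 0) fps_opp fps_add.
Proof. by move=> f; apply/fpsP => n; rewrite /= addNr if_same. Qed.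

HB.instance Definition _ := GRing.isZmodule.Build (fps R) addA addC add0 addN.

Let trunc N f : {poly R} := \poly_(i < N.+1) f i.

Let truncE N f n : (n <= N)%N -> (trunc N f)`_n = f n.
Proof. by move=> le_nN; rewrite coef_poly ltnS le_nN. Qed.

Let mulE N f g n : (n <= N)%N -> fps_mul f g n = (trunc N f * trunc N g)`_n.
Proof.
move=> le_nN; rewrite coefM; apply: eq_bigr => i _.
by rewrite !truncE //; [exact: leq_trans (leq_subr _ _) le_nN
                      | exact: leq_trans (leq_ord i) le_nN].
Qed.

Let mulA : associative fps_mul.
Proof.
move=> f g h; apply/fpsP => n.
transitivity (trunc n f * trunc n g * trunc n h)`_n.
  rewrite -mulrA coefM; apply: eq_bigr => i _.
  by rewrite truncE ?leq_ord // (@mulE n) // leq_subr.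
rewrite coefM; apply: eq_bigr => i _.
by rewrite (truncE _ (leq_subr _ _)) (@mulE n) // leq_ord.
Qed.

Let mulC : commutative fps_mul.
Proof. by move=> f g; apply/fpsP => n; rewrite !(@mulE n) // mulrC. Qed.

Let mul1 : left_id (fpsC 1) fps_mul.
Proof.
move=> f; apply/fpsP => n; rewrite /= big_ord_recl /= mul1r subn0.
by rewrite big1 ?addr0 // => i _; rewrite mul0r.
Qed.

Let mulDl : left_distributive fps_mul +%R.
Proof.
move=> f g h; apply/fpsP => n; rewrite /= -big_split.
by apply: eq_bigr => i _; rewrite /= mulrDl.
Qed.

Let one_neq0 : fpsC 1 != 0.
Proof. by apply/eqP => /fpsP/(_ 0%N)/= /eqP; rewrite oner_eq0. Qed.

HB.instance Definition _ := GRing.Zmodule_isComNzRing.Build (fps R)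
  mulA mulC mul1 mulDl one_neq0.

(* Following the MathComp convention, [f^-1] is the inverse of [f] when [f] is
   invertible, and [f] itself otherwise; see [fps_unit1] below. *)
Definition fps_unit : {pred fps R} := fun f => `[< exists g, g * f = 1 >].
Definition fps_inv f : fps R :=
  if pselect (exists g, g * f = 1) is left ex then projT1 (cid ex) else f.

Let mulV : {in fps_unit, left_inverse 1 fps_inv *%R}.
Proof.
move=> f /asboolP exg; rewrite /fps_inv; case: pselect => // ex.
by case: (cid ex).
Qed.

Let unitPl f g : g * f = 1 -> fps_unit f.
Proof. by move=> e; apply/asboolP; exists g. Qed.

Let inv_out : {in [predC fps_unit], fps_inv =1 id}.
Proof. by move=> f /asboolP nex; rewrite /fps_inv; case: pselect. Qed.

HB.instance Definition _ := GRing.ComNzRing_hasMulInverse.Build (fps R)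
  mulV unitPl inv_out.

Lemma fps_coefD f g n : (f + g) n = f n + g n. Proof. by []. Qed.
Lemma fps_coefN f n : (- f) n = - f n. Proof. by []. Qed.
Lemma fps_coef0 n : (0 : fps R) n = 0. Proof. exact: if_same. Qed.
Lemma fps_coef1 n : (1 : fps R) n = (n == 0%N)%:R. Proof. by case: n. Qed.
Lemma fps_coefM f g n : (f * g) n = \sum_(i < n.+1) f i * g (n - i)%N.
Proof. by []. Qed.

Lemma fps_coefMX f n : (f * fpsX) n = if n is m.+1 then f m else 0.
Proof.
rewrite fps_coefM; case: n => [|n].
  by rewrite big_ord_recl big_ord0 subn0 mulr0 addr0.
rewrite big_ord_recr big_ord_recr /= subnn subSnn mulr0 mulr1 addr0.
rewrite big1 ?add0r // => j _.
by rewrite /= subSn ?(ltnW (ltn_ord j)) // eqSS subn_eq0 leqNgt ltn_ord mulr0.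
Qed.

Lemma fps_coefMXn f i n : (f * fpsX ^+ i) n = if (n < i)%N then 0 else f (n - i)%N.
Proof.
elim: i n => [|i IHi] n; first by rewrite expr0 mulr1 subn0.
by rewrite exprSr mulrA fps_coefMX; case: n => // n; rewrite IHi ltnS subSS.
Qed.

(* [f] is congruent to 1 modulo q^i. *)
Definition fps_eq1mod (i : nat) f := forall n, (n < i)%N -> f n = (1 : fps R) n.

Lemma fps_eq1modE i f : fps_eq1mod i f <-> exists g, f = 1 + g * fpsX ^+ i.
Proof.
split=> [f1|[g ->] n lt_ni]; last by rewrite fps_coefD fps_coefMXn lt_ni addr0.
exists (FPS (fun n => (f - 1) (n + i)%N)); apply/fpsP => n.
rewrite fps_coefD fps_coefMXn; case: ltnP => [/f1->|le_in]; first by rewrite addr0.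
by rewrite /= subnK // addrC subrK.
Qed.

Lemma fps_eq1modM i f g : fps_eq1mod i f -> fps_eq1mod i g -> fps_eq1mod i (f * g).
Proof.
move=> /fps_eq1modE[f' ->] /fps_eq1modE[g' ->]; apply/fps_eq1modE.
exists (f' + g' + f' * g' * fpsX ^+ i).
rewrite mulrDr mulr1 mulrDl mul1r !mulrDl -!addrA.
by congr (_ + (_ + (_ + _))); rewrite -!mulrA; congr (_ * _); exact: mulrCA.
Qed.

Lemma fps_unit1 f : f 0%N = 1 -> f \is a GRing.unit.
Proof.
move=> f0.
(* [s n] lists the first n coefficients of the inverse. *)
pose s := fix s n : seq R := if n is m.+1 then
  rcons (s m) ((m == 0%N)%:R - \sum_(i < m) (s m)`_i * f (m - i)%N) else [::].
have size_s n : size (s n) = n by elim: n => //= n IHn; rewrite size_rcons IHn.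
have sE m n : (n < m)%N -> (s m)`_n = (s n.+1)`_n.
  elim: m => // m IHm; rewrite ltnS leq_eqVlt => /predU1P[->//|lt_nm].
  by rewrite -IHm //= nth_rcons size_s lt_nm.
pose g := FPS (fun n => (s n.+1)`_n).
suff gf : g * f = 1 by apply/unitrPr; exists g; rewrite mulrC.
apply/fpsP => n; rewrite fps_coefM fps_coef1 big_ord_recr /= subnn f0 mulr1.
rewrite nth_rcons size_s ltnn eqxx addrC.
set t := \sum_(i < n) _; set S := (X in _ + X).
suff -> : S = t by rewrite subrK.
by apply: eq_bigr => i _; rewrite (sE n) ?ltn_ord.
Qed.

Lemma fps_eq1modV i f : (0 < i)%N -> fps_eq1mod i f -> fps_eq1mod i f^-1.
Proof.
move=> i_gt0 f1; have f_unit : f \is a GRing.unit by rewrite fps_unit1 ?f1.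
have /fps_eq1modE[g fE] := f1; apply/fps_eq1modE; exists (- (f^-1 * g)).
apply: (mulrI f_unit); rewrite mulrV // mulrDr mulr1 mulNr mulrN !mulrA mulrV //.
by rewrite mul1r {1}fE addrK.
Qed.

Lemma fps_eq1modX i f n : fps_eq1mod i f -> fps_eq1mod i (f ^+ n).
Proof.
move=> f1; elim: n => [|n IHn]; first by rewrite expr0.
by rewrite exprS; apply: fps_eq1modM.
Qed.

Lemma fps_eq1modXz i f (c : int) :
  (0 < i)%N -> fps_eq1mod i f -> fps_eq1mod i (f ^ c).
Proof.
move=> i_gt0 f1; case: c => n; first exact: fps_eq1modX.
by apply: fps_eq1modV => //; apply: fps_eq1modX.
Qed.

(* [fps_infprod u p] : the product of the [u i] over i >= 1 converges to [p] in
   the q-adic topology, i.e. each coefficient of the partial products is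
   eventually equal to that of [p]. *)
Definition fps_infprod (u : nat -> fps R) (p : fps R) : Prop :=
  forall n, exists M, forall N, (M <= N)%N -> (\prod_(1 <= i < N) u i) n = p n.

Lemma fps_infprod_unique u p p' : fps_infprod u p -> fps_infprod u p' -> p = p'.
Proof.
move=> up up'; apply/fpsP => n; have [M pM] := up n; have [M' pM'] := up' n.
by rewrite -(pM (maxn M M')) ?leq_maxl // pM' // leq_maxr.
Qed.

Lemma fps_infprod_exists u :
  (forall i, (0 < i)%N -> fps_eq1mod i (u i)) -> exists p, fps_infprod u p.
Proof.
move=> u1; exists (FPS (fun n => (\prod_(1 <= i < n.+1) u i) n)) => n.
exists n.+1 => N /subnK <-; elim: (N - n.+1)%N => //= k IHk.
have lt_n : (n < k + n.+1)%N by rewrite leq_addl.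
have /u1/fps_eq1modE[g uE] : (0 < k + n.+1)%N by apply: leq_trans lt_n.
rewrite addSn big_nat_recr ?(leq_trans _ lt_n) //.
rewrite -[LHS]/(((\prod_(1 <= i < k + n.+1) u i) * u (k + n.+1)%N) n).
by rewrite uE mulrDr mulr1 mulrA fps_coefD fps_coefMXn lt_n addr0.
Qed.

End Fps.

Notation "''q'" := (fpsX _) (at level 0) : ring_scope.

(* Main.v *)
Require Import Defs.
From mathcomp Require Import all_boot all_order all_algebra.
From mathcomp Require Import freeg.
From mathcomp Require Import zify.
Set Implicit Arguments. Unset Strict Implicit. Unset Printing Implicit Defensive.
Import Order.TTheory GRing.Theory.
Local Open Scope ring_scope.

(** Multiplying the generating function by [1 - z q] turns its coefficient of
    [q^(n+1)] into [F_(n+1) - z F_n] and cancels the factor [(1 - z q)^-1].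
    Every remaining factor only involves monomials [z^k q^n] with [2 k <= n], so
    the coefficient of [z^(n+1-k) q^(n+1)] vanishes when [2 k <= n].  The second
    identity is the same argument with [z^-1] in place of [z]; below [d] is the
    sign of the exponent of [z]. *)

Section Support.
Variable R : comNzRingType.
Implicit Types (x y : laurent R) (f g : fps R) (d k : int).

Lemma laurent_coef_sum (I : Type) (s : seq I) (G : I -> laurent R) k :
  laurent_coef (\sum_(i <- s) G i) k = \sum_(i <- s) laurent_coef (G i) k.
Proof.
apply: (big_morph (fun x => laurent_coef x k)) => [x y|].
  exact: laurent_coefD.
exact: coeff0.
Qed.

Lemma laurent_coefN x k : laurent_coef (- x) k = - laurent_coef x k.
Proof. exact: coeffN. Qed.

Lemma laurent_coef0 k : laurent_coef (0 : laurent R) k = 0.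
Proof. exact: coeff0. Qed.

Lemma laurent_coefM x y k :
  laurent_coef (x * y) k = \sum_(i <- dom x) \sum_(j <- dom y)
    (if k == i + j then laurent_coef x i * laurent_coef y j else 0).
Proof.
rewrite -[x * y]/(laurent_mul x y) laurent_coef_sum.
apply: eq_bigr => i _; rewrite laurent_coef_sum.
by apply: eq_bigr => j _; rewrite laurent_coefU.
Qed.

Lemma laurent_coefMz d x k : laurent_coef ('z^d * x) (d + k) = laurent_coef x k.
Proof.
have xE : x = \sum_(i <- dom x) laurent_mono (laurent_coef x i) i.
  by rewrite [RHS]freeg_sumE.
rewrite {1}xE [in RHS]xE mulr_sumr !laurent_coef_sum.
apply: eq_bigr => i _.
by rewrite laurent_monoM !laurent_coefU mul1r (inj_eq (addrI d)).
Qed.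

(** For [d] equal to 1 or -1 this bounds the degree of [x] in $z^d$ by $m/2$; the factor 2 stands on
    the other side so that everything stays in the integers. *)
Definition half_deg_le d (m : int) x :=
  forall k, m < 2 * d * k -> laurent_coef x k = 0.

(** If $m_1+m_2 < 2d(i+j)$, then $m_1 < 2di$ or $m_2 < 2dj$, so each term of the product has a
    vanishing factor. *)
Lemma half_deg_leM d m1 m2 x y :
  half_deg_le d m1 x -> half_deg_le d m2 y -> half_deg_le d (m1 + m2) (x * y).
Proof.
move=> xm ym k lt_mk; rewrite laurent_coefM.
rewrite big1 // => i _; rewrite big1 // => j _; case: eqP => // kE.
have [lt_i|le_i] := ltP m1 (2 * d * i); first by rewrite xm // mul0r.
rewrite ym ?mulr0 //; move: lt_mk; rewrite kE mulrDr; lia.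
Qed.

Lemma half_deg_leD d m x y :
  half_deg_le d m x -> half_deg_le d m y -> half_deg_le d m (x + y).
Proof. by move=> xm ym k mk; rewrite laurent_coefD xm // ym // addr0. Qed.

Lemma half_deg_leN d m x : half_deg_le d m x -> half_deg_le d m (- x).
Proof. by move=> xm k mk; rewrite laurent_coefN xm // oppr0. Qed.

Lemma half_deg_le0 d m : half_deg_le d m 0.
Proof. by move=> k _; rewrite laurent_coef0. Qed.

Lemma half_deg_le_sum d m (I : Type) (s : seq I) (G : I -> laurent R) :
  (forall i, half_deg_le d m (G i)) -> half_deg_le d m (\sum_(i <- s) G i).
Proof. by move=> Gm k mk; rewrite laurent_coef_sum big1 // => i _; apply: Gm. Qed.

Lemma half_deg_le_mono d m r k :
  2 * d * k <= m -> half_deg_le d m (laurent_mono r k : laurent R).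
Proof.
by move=> le_km j lt_mj; rewrite laurent_coefU; case: eqP => // jE; lia.
Qed.

End Support.

Section HalfSlope.
Variables (R : comNzRingType) (d : int).
Implicit Types (f g : fps (laurent R)).

(** The support lies in the half-plane $2dk \le n$ of exponents of $z^k q^n$. This region is closed
    under addition, so these series form a ring. *)
Definition half_slope f := forall n : nat, half_deg_le d n (f n).

Lemma half_slope1 : half_slope 1.
Proof.
move=> n; rewrite fps_coef1; case: eqP => _; last exact: half_deg_le0.
by apply: half_deg_le_mono; rewrite mulr0.
Qed.

Lemma half_slopeD f g : half_slope f -> half_slope g -> half_slope (f + g).
Proof. by move=> fP gP n; apply: half_deg_leD. Qed.

Lemma half_slopeN f : half_slope f -> half_slope (- f).
Proof. by move=> fP n; apply: half_deg_leN. Qed.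

Lemma half_slopeM f g : half_slope f -> half_slope g -> half_slope (f * g).
Proof.
move=> fP gP n; rewrite fps_coefM; apply: half_deg_le_sum => i.
have -> : n%:Z = i%:Z + (n - i)%N%:Z by have := ltn_ord i; lia.
exact: half_deg_leM.
Qed.

Lemma half_slopeX f n : half_slope f -> half_slope (f ^+ n).
Proof.
move=> fP; elim: n => [|n IHn]; first exact: half_slope1.
by rewrite exprS; apply: half_slopeM.
Qed.

(** Strong induction on the recurrence $g_n = [n=0] - \sum_{i<n} g_i f_{n-i}$ for the coefficients
    of the inverse $g$. *)
Lemma half_slopeV f : f 0%N = 1 -> half_slope f -> half_slope f^-1.
Proof.
move=> f0 fP n; elim/ltn_ind: n => n IHn.
have := fps_coefM f^-1 f n; rewrite mulVr ?fps_unit1 // big_ord_recr subnn f0 mulr1.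
move=> /esym/(canRL (addKr _)) ->.
apply: half_deg_leD; last exact: half_slope1.
apply: half_deg_leN; apply: half_deg_le_sum => i.
have -> : n%:Z = i%:Z + (n - i)%N%:Z by have := ltn_ord i; lia.
by apply: half_deg_leM => //; apply: IHn.
Qed.

Lemma half_slopeXz f (c : int) : f 0%N = 1 -> half_slope f -> half_slope (f ^ c).
Proof.
move=> f0 fP; case: c => n; first exact: half_slopeX.
have ? : fps_eq1mod 1 f by case=> // _; rewrite f0 fps_coef1.
apply: half_slopeV; last exact: half_slopeX.
by rewrite (@fps_eq1modX _ 1) // fps_coef1.
Qed.

Lemma half_slope_prod (u : nat -> fps (laurent R)) m n :
  (forall i, (m <= i)%N -> half_slope (u i)) ->
  half_slope (\prod_(m <= i < n) u i).
Proof.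
move=> uP; rewrite big_nat; apply: big_ind => [||i /andP[/uP]//].
  exact: half_slope1.
exact: half_slopeM.
Qed.

Lemma fps_coefC_mul (r : laurent R) f n : (fpsC r * f) n = r * f n.
Proof.
rewrite fps_coefM big_ord_recl /= subn0 big1 ?addr0 // => i _.
by rewrite mul0r.
Qed.

Lemma half_slope_monoXn (r : R) k i :
  2 * d * k <= i%:Z -> half_slope (fpsC (laurent_mono r k) * 'q ^+ i).
Proof.
move=> le_ki n; rewrite fps_coefMXn; case: ltnP => [_|le_in].
  exact: half_deg_le0.
rewrite /=; case: eqP => _; last exact: half_deg_le0.
by apply: half_deg_le_mono; lia.
Qed.

(** The first factor is tested only after multiplication by $1 - z^d q$, since in the application it
    contains $(1 - z^d q)^{-1}$, whose terms $z^{dm} q^m$ with $m \ge 1$ leave the half-plane. *)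
Lemma coef_stable (u : nat -> fps (laurent R)) (F : nat -> laurent R) :
  d ^+ 2 = 1 -> fps_infprod u (FPS F) ->
  half_slope ((1 - fpsC 'z^d * 'q) * u 1%N) ->
  (forall i, (1 < i)%N -> half_slope (u i)) ->
  forall n k : nat, (2 * k <= n)%N ->
    laurent_coef (F n) (d * (n%:Z - k%:Z))
      = laurent_coef (F n.+1) (d * (n.+1%:Z - k%:Z)).
Proof.
move=> d2 uF u1P uP n k le_kn.
have [M PM] := uF n; have [M' PM'] := uF n.+1.
(* Large enough for the partial product to have its final coefficients at $n$ and $n+1$, and at
   least 2 so that [u 1] can be split off. *)
pose N := maxn 2 (maxn M M').
pose P := \prod_(1 <= i < N) u i.
have {PM} Pn : P n = F n by rewrite PM //; lia.
have {PM'} PSn : P n.+1 = F n.+1 by rewrite PM' //; lia.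
have : half_slope ((1 - fpsC 'z^d * 'q) * P).
  rewrite /P big_ltn; last lia.
  by rewrite mulrA; apply: half_slopeM => //; apply: half_slope_prod.
have PE : ((1 - fpsC 'z^d * 'q) * P) n.+1 = F n.+1 - 'z^d * F n.
  rewrite mulrBl mul1r fps_coefD fps_coefN -mulrA fps_coefC_mul.
  by rewrite ['q * P]mulrC fps_coefMX Pn PSn.
have dE : d * (n.+1%:Z - k%:Z) = d + d * (n%:Z - k%:Z) by lia.
move=> /(_ n.+1 (d * (n.+1%:Z - k%:Z))).
(* Only the exponent at which $z^d F_n$ is read gets split, so that the shift by $z^d$ cancels. *)
rewrite PE laurent_coefD laurent_coefN {3}dE laurent_coefMz => H.
apply/esym/subr0_eq/H.
(* As $d^2 = 1$, the condition is $n+1 < 2(n+1-k)$, that is, $2k \le n$. *)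
by rewrite mulrA -[2 * d * d]mulrA -expr2 d2; lia.
Qed.

End HalfSlope.

Lemma coef0_1sub (R : comNzRingType) (r : laurent R) i :
  (0 < i)%N -> (1 - fpsC r * 'q ^+ i) 0%N = 1.
Proof. by move=> i0; rewrite fps_coefD fps_coefN fps_coefMXn i0 subr0. Qed.

Lemma half_slope_1sub (R : comNzRingType) d (r : R) k i :
  2 * d * k <= i%:Z -> half_slope d (1 - fpsC (laurent_mono r k) * 'q ^+ i).
Proof.
move=> le_ki; apply: half_slopeD; first exact: half_slope1.
by apply: half_slopeN; apply: half_slope_monoXn.
Qed.

(** With $d$ and $k$ equal to 1 or -1, the bound $2dk \le i$ fails for $i \ge 1$ only when $i = 1$
    and $k = d$: this is the factor to be cancelled. *)
Lemma half_slope_geom (R : comNzRingType) d (r : R) k i m :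
  (0 < i)%N -> 2 * d * k <= i%:Z ->
  half_slope d ((1 - fpsC (laurent_mono r k) * 'q ^+ i) ^- m).
Proof.
move=> i_gt0 le_ki; rewrite -exprVn; apply: half_slopeX.
by apply: half_slopeV; [exact: coef0_1sub|exact: half_slope_1sub].
Qed.

(** The factor is free of $z$, and its constant term 1 allows negative [c] too. *)
Lemma half_slope_euler d (eps c : int) i :
  (0 < i)%N -> eps = 1 \/ eps = -1 ->
  half_slope d ((1 + eps%:~R * 'q ^+ i : fps (laurent int)) ^ c).
Proof.
move=> i_gt0 epsP.
have -> : eps%:~R * 'q ^+ i = - (fpsC (laurent_mono (- eps) 0) * 'q ^+ i)
    :> fps (laurent int).
  have oneE : fpsC (laurent_mono 1 0) = 1 :> fps (laurent int) by [].
  case: epsP => ->; last by rewrite opprK oneE mulrN1z mulN1r mul1r.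
  rewrite -mulNr; congr (_ * _); apply/fpsP => n; rewrite fps_coefN fps_coef1 /=.
  case: eqP => _; last by rewrite oppr0.
  by apply/laurentP => j; rewrite laurent_coefN !laurent_coefU; case: eqP.
apply: half_slopeXz; first exact: coef0_1sub.
by apply: half_slope_1sub; rewrite mulr0.
Qed.

Theorem theorem11 (a b : nat -> nat) (c : nat -> int) (eps : int)
    (F : nat -> laurent int) :
  a 1%N = 1%N -> b 1%N = 1%N ->
  eps = 1 \/ eps = -1 ->
  fps_infprod
    (fun i => (1 - fpsC 'z^1 * 'q ^+ i) ^- a i
            * (1 - fpsC 'z^(-1) * 'q ^+ i) ^- b i
            * (1 + eps%:~R * 'q ^+ i) ^ c i)
    (FPS F) ->
  forall n k : nat, (2 * k <= n)%N ->
    laurent_coef (F n) (n%:Z - k%:Z)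
      = laurent_coef (F n.+1) (n.+1%:Z - k%:Z)
    /\ laurent_coef (F n) (- (n%:Z - k%:Z))
      = laurent_coef (F n.+1) (- (n.+1%:Z - k%:Z)).
Proof.
move=> a1 b1 epsP FP n k le_kn.
have unit1 (e : int) : (1 - fpsC 'z^e * 'q : fps (laurent int)) \is a GRing.unit.
  by apply: fps_unit1; rewrite -['q]expr1 coef0_1sub.
split.
- rewrite -[X in laurent_coef (F n) X]mul1r -[X in laurent_coef (F n.+1) X]mul1r.
  apply: (coef_stable _ FP) => // [|i i_gt1].
    (* Because $a_1 = 1$, a single factor $1 - zq$ cancels the whole power. *)
    rewrite a1 !expr1 -!mulrA mulVKr //; apply: half_slopeM.
      by rewrite -['q]expr1; apply: half_slope_geom.
    by rewrite -['q]expr1; apply: half_slope_euler.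
  (* From $i = 2$ on, both geometric factors satisfy the bound. *)
  apply: half_slopeM; last by apply: half_slope_euler => //; lia.
  by apply: half_slopeM; apply: half_slope_geom; lia.
- rewrite -[X in laurent_coef (F n) X]mulN1r -[X in laurent_coef (F n.+1) X]mulN1r.
  apply: (coef_stable _ FP) => // [|i i_gt1].
    (* Now $b_1 = 1$ gives the cancellation, once the power of $1 - zq$ is moved out of the way. *)
    rewrite b1 !expr1 -!mulrA mulrCA mulVKr //; apply: half_slopeM.
      by rewrite -['q]expr1; apply: half_slope_geom.
    by rewrite -['q]expr1; apply: half_slope_euler.
  apply: half_slopeM; last by apply: half_slope_euler => //; lia.
  by apply: half_slopeM; apply: half_slope_geom; lia.
Qed.
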